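(* Let $A$ be a Hopf algebra over a field $k$. The image of the map $H^{\bullet}(A,k)\to H^{\bullet}(A,A)$, $f\mapsto\widehat{f}$, is stable under the brace operation. Moreover, if $\widehat{f}$ and $\widehat{g}$ are the images in $H^{\bullet}(A,A)$ of $f$ and $g$ in $H^{\bullet}(A,k)$, then $$\widehat{f}\circ_i\widehat{g}=\widehat{f\circ_i\widehat{g}}.$$
   Context: $H^{\bullet}(A,M)$ is the Hochschild cohomology of $A$ with coefficients in an $A$-bimodule $M$, computed by the standard complex whose degree $p$ cochains are the $k$-linear maps $A^{\otimes p}\to M$. The field $k$ is an $A$-bimodule via the counit. Sweedler notation with summation omitted: $\Delta(a)=a_1\otimes a_2$. The map $H^{\bullet}(A,k)\to H^{\bullet}(A,A)$ sends the class of a Hochschild cocycle $f:A^{\otimes p}\to k$ to the class of the Hochschild cocycle $\widehat{f}:A^{\otimes p}\to A$ given by $$\widehat{f}(a^1\otimes\dots\otimes a^p)=a^1_1\cdots a^p_1\, f(a^1_2\otimes\dots\otimes a^p_2).$$ Brace operations are given on representing maps as follows: if $F:A^{\otimes p}\to A$, $G:A^{\otimes q}\to A$ and $1\le i\le p$, then $F\circ_iG:A^{\otimes (p+q-1)}\to A$ is defined by $$(F\circ_iG)(a^1\otimes\dots\otimes a^{i-1}\otimes b^1\otimes\dots\otimes b^q\otimes a^{i+1}\otimes\dots\otimes a^p)=F(a^1\otimes\dots\otimes a^{i-1}\otimes G(b^1\otimes\dots\otimes b^q)\otimes a^{i+1}\otimes\dots\otimes a^p).$$ For $f:A^{\otimes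 p}\to k$, the map $f\circ_iG:A^{\otimes(p+q-1)}\to k$ is given by the same formula with $f$ in place of $F$, and $\widehat{f\circ_i\widehat{g}}$ is obtained from $f\circ_i\widehat{g}$ by the formula for the hat above. *)

(* Defs.v *)
From HB Require Import structures.
From mathcomp Require Import all_boot ssralg sesquilinear.
From mathcomp Require Import generic_quotient ring_quotient.
From mathcomp Require Import zify boolp.
From mathcomp Require Import freeg.

Set Implicit Arguments.
Unset Strict Implicit.
Unset Printing Implicit Defensive.

Import GRing.Theory.
Local Open Scope ring_scope.
Local Open Scope quotient_scope.


Section QuotientModule.
Variables (R : nzRingType) (V : lmodType R) (W : submodClosed V).

(* [submodClosed] does not record closure under opposites. *)
Definition zmod_of_submod : {pred V} := W.
HB.instance Definition _ := GRing.AddClosed.copy zmod_of_submod W.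
Lemma submod_oppr_closed : oppr_closed zmod_of_submod.
Proof. by move=> x Wx; rewrite -scaleN1r; apply: rpredZ. Qed.
HB.instance Definition _ :=
  GRing.isOppClosed.Build V zmod_of_submod submod_oppr_closed.

Definition lquot : Type := Quotient.quot zmod_of_submod.
HB.instance Definition _ := GRing.Zmodule.on lquot.

Definition lproj (x : V) : lquot := \pi_(Quotient.quot zmod_of_submod) x.
Definition lrepr (x : lquot) : V := repr (x : Quotient.quot zmod_of_submod).

Lemma lreprK : cancel lrepr lproj.
Proof. exact: reprK. Qed.

Lemma lproj_eq x y : (lproj x = lproj y) <-> (x - y \in W).
Proof.
rewrite (Quotient.idealrBE zmod_of_submod); split; first by move/eqP.
by move/eqP.
Qed.

Lemma lproj_is_zmod_morphism : zmod_morphism lproj.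
Proof. by move=> x y; rewrite /lproj !piE. Qed.
HB.instance Definition _ :=
  GRing.isZmodMorphism.Build V lquot lproj lproj_is_zmod_morphism.

Lemma lrepr_projB x : lrepr (lproj x) - x \in W.
Proof. by apply/lproj_eq; rewrite lreprK. Qed.

Definition lquot_scale a (x : lquot) : lquot := lproj (a *: lrepr x).

Lemma lquot_scale_proj a x : lquot_scale a (lproj x) = lproj (a *: x).
Proof. by apply/lproj_eq; rewrite -scalerBr rpredZ ?lrepr_projB. Qed.

Lemma lquot_scaleA a b x :
  lquot_scale a (lquot_scale b x) = lquot_scale (a * b) x.
Proof. by rewrite -[x]lreprK !lquot_scale_proj scalerA. Qed.
Lemma lquot_scale1 : left_id 1 lquot_scale.
Proof. by move=> x; rewrite -[x]lreprK lquot_scale_proj scale1r. Qed.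
Lemma lquot_scaleDr : right_distributive lquot_scale +%R.
Proof.
move=> a x y; rewrite -[x]lreprK -[y]lreprK -raddfD !lquot_scale_proj.
by rewrite scalerDr raddfD.
Qed.
Lemma lquot_scaleDl x : {morph lquot_scale^~ x : a b / a + b}.
Proof.
by move=> a b; rewrite -[x]lreprK !lquot_scale_proj scalerDl raddfD.
Qed.
HB.instance Definition _ := GRing.Zmodule_isLmodule.Build R lquot
  lquot_scaleA lquot_scale1 lquot_scaleDr lquot_scaleDl.

Lemma lproj_is_scalable : scalable lproj.
Proof. by move=> a x; rewrite -lquot_scale_proj. Qed.
HB.instance Definition _ :=
  GRing.isScalable.Build R V lquot *:%R lproj lproj_is_scalable.

End QuotientModule.


Section FreeModule.
Variables (k : fieldType) (K : choiceType) (M : lmodType k) (f : K -> M).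

Lemma fglift_zmod_morphism : zmod_morphism (fglift f).
Proof. exact: lift_is_additive. Qed.
HB.instance Definition _ := GRing.isZmodMorphism.Build
  {freeg K / k} M (fglift f) fglift_zmod_morphism.

Lemma fgliftE D : fglift f D = \sum_(x <- dom D) coeff x D *: f x.
Proof.
rewrite -{1}[D]freeg_sumE raddf_sum.
by apply: eq_bigr => x _; rewrite /= liftU.
Qed.

Lemma fglift_is_scalable : scalable (fglift f).
Proof.
move=> c D; rewrite [c *: D]/(fgscale c D) /fgscale raddf_sum fgliftE scaler_sumr.
by apply: eq_bigr => x _; rewrite /= liftU scalerA.
Qed.
HB.instance Definition _ := GRing.isScalable.Build
  k {freeg K / k} M *:%R (fglift f) fglift_is_scalable.
End FreeModule.

Definition linear_of (k : fieldType) (U V : lmodType k) (f : U -> V)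
    (f_lin : linear f) : {linear U -> V} :=
  HB.pack_for {linear U -> V} f (GRing.isLinear.Build k U V *:%R f f_lin).

Notation bilin B := (bilinear_for *:%R *:%R B).

Section Tensor.
Variables (k : fieldType) (U V : lmodType k).

Local Notation gen u v := (<< ((u : U), (v : V)) >> : {freeg (U * V) / k}).

(* The subspace of the free vector space on U * V spanned by the bilinearity *)
(* relations.                                                               *)
Inductive tensor_rel : {freeg (U * V) / k} -> Prop :=
| tensor_rel0 : tensor_rel 0
| tensor_relP a x y : tensor_rel x -> tensor_rel y -> tensor_rel (a *: x + y)
| tensor_relL a u u' v :
    tensor_rel (gen (a *: u + u') v - (a *: gen u v + gen u' v))
| tensor_relR a u v v' :
    tensor_rel (gen u (a *: v + v') - (a *: gen u v + gen u v')).

Definition tensor_rels : {pred {freeg (U * V) / k}} :=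
  fun x => `[< tensor_rel x >].

Lemma tensor_rels_addr_closed : addr_closed tensor_rels.
Proof.
split=> [|x y /asboolP rx /asboolP ry]; apply/asboolP.
  exact: tensor_rel0.
by rewrite -[x]scale1r; apply: tensor_relP.
Qed.
Lemma tensor_rels_scaler_closed : GRing.scaler_closed tensor_rels.
Proof.
move=> a x /asboolP rx; apply/asboolP; rewrite -[_ *: _]addr0.
by apply: tensor_relP => //; apply: tensor_rel0.
Qed.
HB.instance Definition _ := GRing.isAddClosed.Build
  {freeg (U * V) / k} tensor_rels tensor_rels_addr_closed.
HB.instance Definition _ := GRing.isScaleClosed.Build
  k {freeg (U * V) / k} tensor_rels tensor_rels_scaler_closed.

Definition tensor : Type := lquot tensor_rels.
HB.instance Definition _ := GRing.Lmodule.on tensor.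

Definition tens (u : U) (v : V) : tensor := lproj tensor_rels (gen u v).

Lemma tens_bilinear : bilin tens.
Proof.
split=> [v a u u'|u a v v']; rewrite /tens -linearP; apply/lproj_eq/asboolP.
  exact: tensor_relL.
exact: tensor_relR.
Qed.

(* The linear map induced by a bilinear map B: see tliftE and tlift_linear. *)
Definition tlift (W : lmodType k) (B : U -> V -> W) (t : tensor) : W :=
  fglift (fun uv => B uv.1 uv.2) (lrepr t).

Lemma tlift_sum (W : lmodType k) (B : U -> V -> W) t :
  tlift B t =
  \sum_(z <- dom (lrepr t)) coeff z (lrepr t) *: B z.1 z.2.
Proof. exact: fgliftE. Qed.

Lemma tensor_sum t :
  t = \sum_(z <- dom (lrepr t)) coeff z (lrepr t) *: tens z.1 z.2.
Proof.
rewrite -{1}[t]lreprK -{1}[lrepr t]freeg_sumE raddf_sum.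
apply: eq_bigr => -[u v] _; rewrite /tens -linearZ /=; congr (lproj _ _).
set c := coeff _ _; apply/eqP/freeg_eqP => x.
by rewrite coeffZ !coeffU mul1r.
Qed.

Lemma tensor_ext (W : lmodType k) (f g : {linear tensor -> W}) :
  (forall u v, f (tens u v) = g (tens u v)) -> f =1 g.
Proof.
move=> fg t; rewrite [t]tensor_sum !linear_sum.
by apply: eq_bigr => z _; rewrite !linearZ /= fg.
Qed.

Section Lift.
Variables (W : lmodType k) (B : U -> V -> W).

Lemma tlift_comp (W' : lmodType k) (f : {linear W -> W'}) t :
  f (tlift B t) = tlift (fun u v => f (B u v)) t.
Proof.
rewrite !tlift_sum linear_sum.
by apply: eq_bigr => z _; rewrite linearZ.
Qed.

Lemma tlift_comb (B1 B2 : U -> V -> W) a t :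
  (forall u v, B u v = a *: B1 u v + B2 u v) ->
  tlift B t = a *: tlift B1 t + tlift B2 t.
Proof.
move=> BE; rewrite !tlift_sum scaler_sumr -big_split.
by apply: eq_bigr => z _; rewrite BE /= scalerDr !scalerA mulrC.
Qed.

Hypothesis Bbilin : bilin B.

Lemma tlift_rel x : tensor_rel x -> fglift (fun uv => B uv.1 uv.2) x = 0.
Proof.
elim=> [|a y z _ y0 _ z0|a u u' v|a u v v'].
- by rewrite raddf0.
- by rewrite linearP /= y0 z0 scaler0 addr0.
- rewrite linearB linearP /= !liftU !scale1r /=.
  by rewrite (Bbilin.1 v) subrr.
- rewrite linearB linearP /= !liftU !scale1r /=.
  by rewrite (Bbilin.2 u) subrr.
Qed.

Lemma tlift_proj x :
  tlift B (lproj tensor_rels x) = fglift (fun uv => B uv.1 uv.2) x.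
Proof.
have /asboolP/tlift_rel := lrepr_projB tensor_rels x.
by rewrite linearB => /subr0_eq.
Qed.

Lemma tliftE u v : tlift B (tens u v) = B u v.
Proof. by rewrite tlift_proj liftU scale1r. Qed.

Lemma tlift_linear : linear (tlift B).
Proof.
move=> a x y; rewrite -[x]lreprK -[y]lreprK -linearP !tlift_proj.
by rewrite linearP.
Qed.
End Lift.

End Tensor.


Section TensorPower.
Variables (k : fieldType) (A : lmodType k).

Fixpoint tpow (n : nat) : lmodType k :=
  if n is n'.+1 then (tensor A (tpow n') : lmodType k) else k^o.

(* The tensor a_1 ⊗ ... ⊗ a_n, for a list s = [:: a_1; ...; a_n] of size n. *)
Fixpoint tpure (n : nat) (s : seq A) : tpow n :=
  if n is n'.+1 then tens (head 0 s) (tpure n' (behead s)) else (1 : k^o).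

(* Maps defined on lists of size n, linear in each entry; their values on *)
(* lists of another size are irrelevant.                                  *)
Definition multilin (n : nat) (M : lmodType k) (phi : seq A -> M) : Prop :=
  forall s1 s2, (size s1 + size s2).+1 = n ->
  linear (fun x => phi (s1 ++ x :: s2)).

(* The linear map induced by a multilinear map: see tpliftE. *)
Fixpoint tplift (n : nat) (M : lmodType k) (phi : seq A -> M) : tpow n -> M :=
  if n is n'.+1 return tpow n -> M then
    tlift (fun a t => tplift (fun s => phi (a :: s)) t)
  else fun c : k => c *: phi [::].

Lemma tplift_comb n (M : lmodType k) (phi phi1 phi2 : seq A -> M) a
    (t : tpow n) :
  (forall s, size s = n -> phi s = a *: phi1 s + phi2 s) ->
  tplift phi t = a *: tplift phi1 t + tplift phi2 t.
Proof.
elim: n phi phi1 phi2 t => [|n IH] phi phi1 phi2 t phiE /=.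
  by rewrite phiE // scalerDr !scalerA mulrC.
apply: tlift_comb => u v; apply: IH => s sn; apply: phiE.
by rewrite /= sn.
Qed.

Lemma multilin_cons n (M : lmodType k) (phi : seq A -> M) a :
  multilin n.+1 phi -> multilin n (fun s => phi (a :: s)).
Proof. by move=> lphi s1 s2 e; apply: (lphi (a :: s1)); rewrite -e. Qed.

Lemma tplift_bilin n (M : lmodType k) (phi : seq A -> M) :
  (forall phi : seq A -> M, multilin n phi -> linear (@tplift n M phi)) ->
  multilin n.+1 phi ->
  bilin (fun a (t : tpow n) => tplift (fun s => phi (a :: s)) t).
Proof.
move=> IH lphi; split=> [t c a a'|a]; last exact/IH/multilin_cons.
apply: tplift_comb => s sn; apply: (lphi [::]).
by rewrite add0n sn.
Qed.

Lemma tplift_linear n (M : lmodType k) (phi : seq A -> M) :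
  multilin n phi -> linear (@tplift n M phi).
Proof.
elim: n phi => [|n IH] phi lphi /=.
  by move=> c x y; rewrite scalerDl scalerA.
exact/tlift_linear/tplift_bilin.
Qed.

Lemma tpliftE n (M : lmodType k) (phi : seq A -> M) s :
  multilin n phi -> size s = n -> tplift phi (tpure n s) = phi s.
Proof.
elim: n s phi => [|n IH] [|a s] phi lphi //=; first by rewrite scale1r.
case=> sn.
rewrite tliftE; last by apply: tplift_bilin => // psi; apply: tplift_linear.
by rewrite IH //; apply: multilin_cons.
Qed.

Lemma tpure_multilin n : multilin n (tpure n).
Proof.
elim: n => [|n IH]; first by move=> s1 s2.
move=> [|b s1] s2 /succn_inj e c x y /=; first by rewrite (tens_bilinear _ _).1.
by rewrite (IH s1 s2 e) (tens_bilinear _ _).2.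
Qed.

Lemma tpow_ext n (M : lmodType k) (f g : {linear tpow n -> M}) :
  (forall s, size s = n -> f (tpure n s) = g (tpure n s)) -> f =1 g.
Proof.
elim: n f g => [|n IH] f g fg.
  move=> c; rewrite -[c]mulr1.
  have := fg [::] erefl; rewrite /= => fg1.
  by rewrite -[c * 1]/(c *: (1 : k^o)) !linearZ /= fg1.
apply: tensor_ext => a.
have flin (h : {linear tpow n.+1 -> M}) :
    linear (fun t : tpow n => h (tens a t)).
  by move=> c x y; rewrite (tens_bilinear _ _).2 linearP.
pose H h := linear_of (flin h).
by apply: (IH (H f) (H g)) => s sn; apply: (fg (a :: s)); rewrite /= sn.
Qed.

End TensorPower.


Section LinearMaps.
Variables (k : fieldType) (U V : lmodType k).

Definition linmap : Type := {linear U -> V}.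
Identity Coercion linmap_linear : linmap >-> GRing.Linear.type.

HB.instance Definition _ := gen_eqMixin linmap.
HB.instance Definition _ := gen_choiceMixin linmap.

Lemma linmapP (f g : linmap) : f =1 g -> f = g.
Proof.
case: f g => [f [[fA] [fZ]]] [g [[gA] [gZ]]] /= /funext fg.
by case: _ / fg in gA gZ *; rewrite (Prop_irrelevance fA gA) (Prop_irrelevance fZ gZ).
Qed.

Definition linmap0 : linmap := \0.
Definition linmap_opp (f : linmap) : linmap := \- f.
Definition linmap_add (f g : linmap) : linmap := f \+ g.
Definition linmap_scale (a : k) (f : linmap) : linmap := a \*: f.

Lemma linmap_addA : associative linmap_add.
Proof. by move=> f g h; apply: linmapP => x /=; rewrite addrA. Qed.
Lemma linmap_addC : commutative linmap_add.
Proof. by move=> f g; apply: linmapP => x /=; rewrite addrC. Qed.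
Lemma linmap_add0 : left_id linmap0 linmap_add.
Proof. by move=> f; apply: linmapP => x /=; rewrite add0r. Qed.
Lemma linmap_addN : left_inverse linmap0 linmap_opp linmap_add.
Proof. by move=> f; apply: linmapP => x /=; rewrite addNr. Qed.
HB.instance Definition _ := GRing.isZmodule.Build linmap
  linmap_addA linmap_addC linmap_add0 linmap_addN.

Lemma linmap_scaleA a b f :
  linmap_scale a (linmap_scale b f) = linmap_scale (a * b) f.
Proof. by apply: linmapP => x /=; rewrite scalerA. Qed.
Lemma linmap_scale1 : left_id 1 linmap_scale.
Proof. by move=> f; apply: linmapP => x /=; rewrite scale1r. Qed.
Lemma linmap_scaleDr : right_distributive linmap_scale +%R.
Proof. by move=> a f g; apply: linmapP => x /=; rewrite scalerDr. Qed.
Lemma linmap_scaleDl f : {morph linmap_scale^~ f : a b / a + b}.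
Proof. by move=> a b; apply: linmapP => x /=; rewrite scalerDl. Qed.
HB.instance Definition _ := GRing.Zmodule_isLmodule.Build k linmap
  linmap_scaleA linmap_scale1 linmap_scaleDr linmap_scaleDl.

Lemma linmapDE (f g : linmap) x : (f + g) x = f x + g x.
Proof. by []. Qed.
Lemma linmapZE a (f : linmap) x : (a *: f) x = a *: f x.
Proof. by []. Qed.
End LinearMaps.


Section TensorAlgebra.
Variables (k : fieldType) (A : algType k).

(* (a ⊗ b)(c ⊗ d) = ac ⊗ bd *)
Definition tmul (s t : tensor A A) : tensor A A :=
  tlift (fun a b => tlift (fun c d => tens (a * c) (b * d)) t) s.

End TensorAlgebra.

(* In comulA the two sides of coassociativity are compared in A ⊗ (A ⊗ A). *)
HB.mixin Record Algebra_isHopf (k : fieldType) A of GRing.Algebra k A := {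
  comul : {linear A -> tensor A A};
  counit : {linear A -> k^o};
  antipode : {linear A -> A};
  comulA : forall a,
    tlift (fun x y => tlift (fun x1 x2 => tens x1 (tens x2 y)) (comul x))
      (comul a)
    = tlift (fun x y => tens x (comul y)) (comul a);
  counitl : forall a, tlift (fun x y => counit x *: y) (comul a) = a;
  counitr : forall a, tlift (fun x y => counit y *: x) (comul a) = a;
  comul1 : comul 1 = tens 1 1;
  comulM : forall a b, comul (a * b) = tmul (comul a) (comul b);
  counit1 : counit 1 = 1;
  counitM : forall a b, counit (a * b) = counit a * counit b;
  antipodel : forall a,
    tlift (fun x y => antipode x * y) (comul a) = (counit a)%:A;
  antipoder : forall a,
    tlift (fun x y => x * antipode y) (comul a) = (counit a)%:A
}.

#[short(type="hopfAlgType")]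
HB.structure Definition HopfAlgebra (k : fieldType) :=
  {A of Algebra_isHopf k A & GRing.Algebra k A}.



(* A left and a right A-module structure on M which commute and induce the *)
(* same (given) structure of k-vector space on M.                         *)
Record bimodule (k : fieldType) (A : algType k) := Bimodule {
  bimod_sort :> lmodType k;
  lact : A -> bimod_sort -> bimod_sort;
  ract : bimod_sort -> A -> bimod_sort;
  lact_bilin : bilin lact;
  ract_bilin : bilin ract;
  lact1 : forall m, lact 1 m = m;
  ract1 : forall m, ract m 1 = m;
  lactM : forall a b m, lact (a * b) m = lact a (lact b m);
  ractM : forall m a b, ract m (a * b) = ract (ract m a) b;
  lractA : forall a m b, ract (lact a m) b = lact a (ract m b)
}.

Definition cochain (k : fieldType) (A : algType k) (n : nat) (M : lmodType k) :=
  linmap (tpow A n) M.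

(* [lia] does not identify convertible carrier types of [size]. *)
Ltac lia_sizes s1 s2 :=
  let a := fresh "a" in let b := fresh "b" in
  pose a := size s1; pose b := size s2;
  rewrite -?[size s1]/a -?[size s2]/b;
  repeat match goal with H : context [size s1] |- _ => rewrite -?[size s1]/a in H end;
  repeat match goal with H : context [size s2] |- _ => rewrite -?[size s2]/b in H end;
  clearbody a b; lia.

Section Multilinear.
Variables (k : fieldType) (A : lmodType k).
Implicit Types M : lmodType k.

Lemma multilin_comb n M (phi psi : seq A -> M) c :
  multilin n phi -> multilin n psi -> multilin n (fun s => c *: phi s + psi s).
Proof.
move=> lphi lpsi s1 s2 e a x y; rewrite (lphi _ _ e) (lpsi _ _ e).
rewrite !scalerDr !scalerA -!addrA [a * c]mulrC; congr (_ + _).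
by rewrite addrCA.
Qed.

Lemma multilin0 n M : multilin n (fun _ : seq A => 0 : M).
Proof. by move=> s1 s2 e a x y; rewrite scaler0 addr0. Qed.

Lemma multilin_scale n M (phi : seq A -> M) c :
  multilin n phi -> multilin n (fun s => c *: phi s).
Proof.
by move=> lphi s1 s2 e a x y; rewrite (lphi _ _ e) scalerDr !scalerA mulrC.
Qed.

Lemma multilin_add n M (phi psi : seq A -> M) :
  multilin n phi -> multilin n psi -> multilin n (fun s => phi s + psi s).
Proof.
move=> lphi lpsi s1 s2 e a x y; rewrite (lphi _ _ e) (lpsi _ _ e) scalerDr.
by rewrite addrACA.
Qed.

Lemma multilin_sum n M (I : Type) (r : seq I) (phi : I -> seq A -> M) :
  (forall i, multilin n (phi i)) -> multilin n (fun s => \sum_(i <- r) phi i s).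
Proof.
move=> lphi s1 s2 e a x y; rewrite scaler_sumr -big_split.
by apply: eq_bigr => i _; rewrite (lphi i _ _ e).
Qed.

Lemma multilin_comp n M (F : {linear tpow A n -> M}) : multilin n (fun s => F (tpure n s)).
Proof. by move=> s1 s2 e a x y; rewrite (tpure_multilin e) linearP. Qed.

Lemma take_mid (T : Type) (s1 s2 : seq T) z i : (size s1 < i)%N ->
  take i (s1 ++ z :: s2) = s1 ++ z :: take (i - (size s1).+1) s2.
Proof.
by move=> lt; rewrite -cat_rcons take_cat size_rcons ltnNge lt cat_rcons.
Qed.

Lemma drop_mid (T : Type) (s1 s2 : seq T) z i : (size s1 < i)%N ->
  drop i (s1 ++ z :: s2) = drop (i - (size s1).+1) s2.
Proof. by move=> lt; rewrite -cat_rcons drop_cat size_rcons ltnNge lt. Qed.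

(* Substituting the value of a multilinear map of q arguments for argument i *)
(* of a multilinear map of p + 1 arguments.                                  *)
Lemma multilin_insert p q M (phi : seq A -> M) (psi : seq A -> A) i :
  (i <= p)%N -> multilin p.+1 phi -> multilin q psi ->
  multilin (p + q)
    (fun s => phi (take i s ++ psi (take q (drop i s)) :: drop (i + q) s)).
Proof.
move=> ip lphi lpsi s1 s2 e c x y.
have [ltj|lej] := ltnP (size s1) i.
  have E z := take_mid s2 z ltj.
  have E1 z j : (i <= j)%N ->
      drop j (s1 ++ z :: s2) = drop (j - (size s1).+1) s2.
    by move=> ij; apply: drop_mid (leq_trans ltj ij).
  rewrite !E !E1 ?leq_addr // -!catA !cat_cons.
  by apply: lphi; rewrite size_cat /= size_takel ?size_drop;
    lia_sizes s1 s2.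
have [ltj|gtj] := ltnP (size s1) (i + q).
  have E z : take i (s1 ++ z :: s2) = take i s1 by rewrite takel_cat.
  have E1 z := drop_mid s2 z ltj.
  have E2 z : take q (drop i (s1 ++ z :: s2)) =
              drop i s1 ++ z :: take (i + q - (size s1).+1) s2.
    rewrite -{1}(cat_take_drop i s1) -catA drop_size_cat; last first.
      by rewrite size_takel.
    rewrite take_mid size_drop; last by lia_sizes s1 s2.
    by congr (_ ++ _ :: take _ _); lia_sizes s1 s2.
  rewrite !E !E1 !E2 lpsi.
    by apply: lphi; rewrite size_takel ?size_drop; lia_sizes s1 s2.
  by rewrite size_drop size_takel; lia_sizes s1 s2.
have E j z : (j <= size s1)%N -> take j (s1 ++ z :: s2) = take j s1.
  by move=> ?; rewrite takel_cat.
have E1 z j : (j <= size s1)%N -> drop j (s1 ++ z :: s2) = drop j s1 ++ z :: s2.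
  move=> le; rewrite -{1}(cat_take_drop j s1) -catA drop_size_cat //.
  by rewrite size_takel.
have E2 z : take q (drop i (s1 ++ z :: s2)) = take q (drop i s1).
  by rewrite E1 // takel_cat // size_drop; lia_sizes s1 s2.
rewrite !E // !E2 !E1 // -!cat_cons !catA.
apply: lphi; rewrite size_cat /= size_takel ?size_drop;
  by lia_sizes s1 s2.
Qed.

End Multilinear.

Section HochschildComplex.
Variables (k : fieldType) (A : algType k).

Lemma multilin_mul_adj n (M : lmodType k) (phi : seq A -> M) i :
  (i < n)%N -> multilin n phi ->
  multilin n.+1 (fun s => phi (take i s ++ s`_i * s`_i.+1 :: drop i.+2 s)).
Proof.
case: n => // n le_in lphi.
pose psi (s : seq A) := s`_0 * s`_1.
have lpsi : multilin 2 psi.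
  move=> [|b [|? ?]] [|d [|? ?]] //= _ c x y; rewrite /psi /=.
    by rewrite mulrDl scalerAl.
  by rewrite mulrDr scalerAr.
have := multilin_insert (le_in : (i <= n)%N) lphi lpsi.
rewrite !addn2 => ins s1 s2 e c x y; have := ins s1 s2 e c x y.
by rewrite /psi !nth_take // !nth_drop addn0 addn1.
Qed.

Section Differential.
Variables (M : bimodule A) (n : nat) (F : cochain A n M).

(* The value of the Hochschild coboundary of F at a_0 ⊗ ... ⊗ a_n. *)
Definition hoch_form (s : seq A) : M :=
  lact s`_0 (F (tpure n (behead s)))
  + \sum_(i < n) (-1) ^+ i.+1 *:
      F (tpure n (take i s ++ s`_i * s`_i.+1 :: drop i.+2 s))
  + (-1) ^+ n.+1 *: ract (F (tpure n (take n s))) s`_n.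

Lemma hoch_form_multilin : multilin n.+1 hoch_form.
Proof.
have lF := multilin_comp F.
apply: multilin_add; last apply: multilin_scale.
  apply: multilin_add.
    move=> [|b s1] s2 e c x y /=; first exact: (lact_bilin M).1.
    by rewrite lF ?(lact_bilin M).2 //; case: e => /= <-.
  by apply: multilin_sum => i; apply: multilin_scale; apply: (multilin_mul_adj _ lF).
move=> s1 s2; elim/last_ind: s2 => [|s2 b _] e c x y.
  have sE : size s1 = n by move: e => /= [<-]; rewrite addn0.
  rewrite !take_size_cat // !nth_cat sE ltnn subnn /=.
  exact: (ract_bilin M).2.
move: e; rewrite size_rcons => -[e].
have takeE z : take n (s1 ++ z :: rcons s2 b) = s1 ++ z :: s2.
  rewrite -rcons_cons -rcons_cat -cats1 take_size_cat // size_cat /=.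
  by rewrite -e addnS.
have nthE z : (s1 ++ z :: rcons s2 b)`_n = b.
  rewrite -rcons_cons -rcons_cat nth_rcons size_cat /= -e addnS.
  by rewrite ltnn eqxx.
rewrite !takeE !nthE lF ?(ract_bilin M).1 //.
by rewrite -e addnS.
Qed.

Definition hoch_d : cochain A n.+1 M :=
  linear_of (tplift_linear hoch_form_multilin).

Lemma hoch_dE s : size s = n.+1 -> hoch_d (tpure n.+1 s) = hoch_form s.
Proof. exact/tpliftE/hoch_form_multilin. Qed.
End Differential.

Section Cohomology.
Variables (M : bimodule A) (n : nat).

Lemma hoch_d_linear : linear (@hoch_d M n).
Proof.
move=> c F G; apply/linmapP/tpow_ext => s sn.
rewrite [RHS]/(c *: hoch_d F (tpure n.+1 s) + hoch_d G (tpure n.+1 s)).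
rewrite !hoch_dE // /hoch_form.
have FG t : (c *: F + G) t = c *: F t + G t by [].
rewrite !FG (lact_bilin M).2 (ract_bilin M).1.
under eq_bigr do rewrite FG scalerDr scalerA mulrC -scalerA.
rewrite big_split /= -scaler_sumr [_ *: (_ + ract _ _)]scalerDr.
rewrite [_ *: (c *: ract _ _)]scalerA [_ * c]mulrC -scalerA !scalerDr.
by rewrite [RHS]addrACA [X in _ = X + _]addrACA.
Qed.

HB.instance Definition _ := GRing.isLinear.Build
  k (cochain A n M) (cochain A n.+1 M) *:%R (@hoch_d M n) hoch_d_linear.

Definition cocycles : {pred cochain A n M} := fun F => hoch_d F == 0.

Lemma cocycles_addr_closed : addr_closed cocycles.
Proof.
split=> [|F G /eqP dF /eqP dG]; apply/eqP; first by rewrite raddf0.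
by rewrite raddfD /= dF dG addr0.
Qed.
Lemma cocycles_scaler_closed : GRing.scaler_closed cocycles.
Proof. by move=> c F /eqP dF; apply/eqP; rewrite linearZ /= dF scaler0. Qed.
HB.instance Definition _ := GRing.isAddClosed.Build
  (cochain A n M) cocycles cocycles_addr_closed.
HB.instance Definition _ := GRing.isScaleClosed.Build
  k (cochain A n M) cocycles cocycles_scaler_closed.

Record cocycle := Cocycle {
  cocycle_val :> cochain A n M;
  cocycleP : cocycle_val \in cocycles
}.
HB.instance Definition _ := [isSub for cocycle_val].
HB.instance Definition _ := [Choice of cocycle by <:].
HB.instance Definition _ := [SubChoice_isSubLmodule of cocycle by <:].
End Cohomology.
End HochschildComplex.

Section HochschildCohomology.
Variables (k : fieldType) (A : algType k) (M : bimodule A).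

Definition is_coboundary n : cochain A n M -> Prop :=
  if n is n'.+1 return cochain A n M -> Prop
  then fun F => exists G : cochain A n' M, F = hoch_d G
  else fun F => F = 0.

Definition coboundaries n : {pred cocycle M n} :=
  fun F => `[< is_coboundary (F : cochain A n M) >].

Lemma coboundaries_addr_closed n : addr_closed (@coboundaries n).
Proof.
case: n => [|n]; split=> [|F G /asboolP /= dF /asboolP /= dG]; apply/asboolP => //=.
- by rewrite dF dG addr0.
- by exists 0; rewrite raddf0.
- by case: dF dG => [F' ->] [G' ->]; exists (F' + G'); rewrite raddfD.
Qed.
Lemma coboundaries_scaler_closed n : GRing.scaler_closed (@coboundaries n).
Proof.
case: n => [|n] c F /asboolP /= dF; apply/asboolP => /=.
  by rewrite dF scaler0.
by case: dF => [F' ->]; exists (c *: F'); rewrite linearZ.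
Qed.
HB.instance Definition _ n := GRing.isAddClosed.Build
  (cocycle M n) (@coboundaries n) (@coboundaries_addr_closed n).
HB.instance Definition _ n := GRing.isScaleClosed.Build
  k (cocycle M n) (@coboundaries n) (@coboundaries_scaler_closed n).

Definition HH n : Type := lquot (@coboundaries n).
HB.instance Definition _ n := GRing.Lmodule.on (HH n).

Definition hclass n (F : cocycle M n) : HH n := lproj (@coboundaries n) F.

End HochschildCohomology.

Section Coefficients.
Variables (k : fieldType).

Section Regular.
Variable A : algType k.

Lemma mulr_bilin : bilin (fun a b : A => a * b).
Proof.
split=> [b c x y|a c x y] /=; first by rewrite mulrDl scalerAl.
by rewrite mulrDr scalerAr.
Qed.

Definition regular_bimod : bimodule A :=
  @Bimodule k A A (fun a b => a * b) (fun a b => a * b) mulr_bilin mulr_bilin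
    (@mul1r A) (@mulr1 A) (fun a b c => esym (mulrA a b c)) (@mulrA A)
    (fun a b c => esym (mulrA a b c)).
End Regular.

Variable A : hopfAlgType k.

Let lact_k (a : A) (c : k^o) : k^o := counit a * c.
Let ract_k (c : k^o) (a : A) : k^o := c * counit a.

Lemma lact_k_bilin : bilin lact_k.
Proof.
split=> [e c x y|a c x y]; rewrite /lact_k.
  by rewrite linearP mulrDl; congr (_ + _); apply: (esym (mulrA c _ _)).
by rewrite mulrDr; congr (_ + _); apply: (mulrCA _ c).
Qed.
Lemma ract_k_bilin : bilin ract_k.
Proof.
split=> [a c x y|e c x y]; rewrite /ract_k.
  by rewrite mulrDl; congr (_ + _); apply: (esym (mulrA c _ _)).
by rewrite linearP mulrDr; congr (_ + _); apply: (mulrCA _ c).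
Qed.
Lemma lact_k1 c : lact_k 1 c = c. Proof. by rewrite /lact_k counit1 mul1r. Qed.
Lemma ract_k1 c : ract_k c 1 = c. Proof. by rewrite /ract_k counit1 mulr1. Qed.
Lemma lact_kM a b c : lact_k (a * b) c = lact_k a (lact_k b c).
Proof. by rewrite /lact_k counitM mulrA. Qed.
Lemma ract_kM c a b : ract_k c (a * b) = ract_k (ract_k c a) b.
Proof. by rewrite /ract_k counitM mulrA. Qed.
Lemma lract_kA a c b : ract_k (lact_k a c) b = lact_k a (ract_k c b).
Proof. by rewrite /ract_k /lact_k mulrA. Qed.

Definition trivial_bimod : bimodule A :=
  Bimodule lact_k_bilin ract_k_bilin lact_k1 ract_k1 lact_kM ract_kM lract_kA.

End Coefficients.

Section Sweedler.
Variables (k : fieldType) (A : hopfAlgType k).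

(* For s = [:: a^1; ...; a^n], the sum, in Sweedler notation, of the terms *)
(* phi [:: a^1_1; ...; a^n_1] [:: a^1_2; ...; a^n_2].                      *)
Fixpoint sweedler (M : lmodType k) (s : seq A) (phi : seq A -> seq A -> M) : M :=
  if s is a :: s' then
    tlift (fun x y => sweedler s' (fun xs ys => phi (x :: xs) (y :: ys)))
      (comul a)
  else phi [::] [::].

Definition bimultilin n (M : lmodType k) (phi : seq A -> seq A -> M) : Prop :=
  (forall ys, size ys = n -> multilin n (phi^~ ys)) /\
  (forall xs, size xs = n -> multilin n (phi xs)).

Lemma sweedler_comb (M : lmodType k) (phi phi1 phi2 : seq A -> seq A -> M) c s :
  (forall xs ys, size xs = size s -> size ys = size s ->
     phi xs ys = c *: phi1 xs ys + phi2 xs ys) ->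
  sweedler s phi = c *: sweedler s phi1 + sweedler s phi2.
Proof.
elim: s phi phi1 phi2 => [|a s IH] phi phi1 phi2 phiE /=; first exact: phiE.
apply: tlift_comb => u v; apply: IH => xs ys xsE ysE.
by apply: phiE; rewrite /= ?xsE ?ysE.
Qed.

Lemma eq_tlift (U V W : lmodType k) (B B' : U -> V -> W) t :
  (forall u v, B u v = B' u v) -> tlift B t = tlift B' t.
Proof.
move=> BE; rewrite !tlift_sum; by apply: eq_bigr => z _; rewrite BE.
Qed.

Lemma eq_sweedler (M : lmodType k) (phi psi : seq A -> seq A -> M) s :
  (forall xs ys, size xs = size s -> size ys = size s -> phi xs ys = psi xs ys) ->
  sweedler s phi = sweedler s psi.
Proof.
elim: s phi psi => [|a s IH] phi psi phiE /=; first exact: phiE.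
apply: eq_tlift => u v; apply: IH => xs ys xsE ysE.
by apply: phiE; rewrite /= ?xsE ?ysE.
Qed.

Lemma sweedler_comp (M M' : lmodType k) (f : {linear M -> M'}) phi s :
  f (sweedler s phi) = sweedler s (fun xs ys => f (phi xs ys)).
Proof.
elim: s phi => [//|a s IH] phi /=.
by rewrite tlift_comp; apply: eq_tlift => u v; rewrite IH.
Qed.

Lemma sweedler_cat (M : lmodType k) (phi : seq A -> seq A -> M) s t :
  sweedler (s ++ t) phi =
  sweedler s (fun xs ys =>
    sweedler t (fun xs' ys' => phi (xs ++ xs') (ys ++ ys'))).
Proof.
by elim: s phi => [//|a s IH] phi /=; apply: eq_tlift => u v; rewrite IH.
Qed.

Lemma bimultilin_cons n (M : lmodType k) (phi : seq A -> seq A -> M) x y :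
  bimultilin n.+1 phi -> bimultilin n (fun xs ys => phi (x :: xs) (y :: ys)).
Proof.
move=> [l1 l2]; split=> zs zsE.
  by apply: (@multilin_cons _ _ n M (phi^~ (y :: zs))); apply: l1; rewrite /= zsE.
by apply: (@multilin_cons _ _ n M (phi (x :: zs))); apply: l2; rewrite /= zsE.
Qed.

Lemma sweedler_bilin n (M : lmodType k) (phi : seq A -> seq A -> M) s :
  bimultilin n.+1 phi -> size s = n ->
  bilin (fun x y => sweedler s (fun xs ys => phi (x :: xs) (y :: ys))).
Proof.
move=> [l1 l2] sE; split=> [y c x x'|x c y y'];
  apply: sweedler_comb => xs ys; rewrite sE => xsE ysE.
  have yE : size (y :: ys) = n.+1 by rewrite /= ysE.
  by apply: (l1 _ yE [::] xs); rewrite xsE.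
have xE : size (x :: xs) = n.+1 by rewrite /= xsE.
by apply: (l2 _ xE [::] ys); rewrite ysE.
Qed.

Lemma sweedler_multilin n (M : lmodType k) (phi : seq A -> seq A -> M) :
  bimultilin n phi -> multilin n (fun s => sweedler s phi).
Proof.
elim: n phi => [|n IH] phi lphi; first by move=> s1 s2.
move=> [|b s1] s2 [e] c x y /=.
  by rewrite linearP (tlift_linear (sweedler_bilin lphi e)).
apply: tlift_comb => u v; apply: (IH _ _ s1 s2 e).
exact: bimultilin_cons.
Qed.

Lemma sweedlerM n (M : lmodType k) (phi : seq A -> seq A -> M) a b s :
  bimultilin n.+1 phi -> size s = n ->
  sweedler (a * b :: s) phi =
  tlift (fun a1 a2 => tlift (fun b1 b2 =>
    sweedler s (fun xs ys => phi (a1 * b1 :: xs) (a2 * b2 :: ys)))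
    (comul b)) (comul a).
Proof.
move=> lphi sE /=; rewrite comulM /tmul.
have lB := sweedler_bilin lphi sE.
pose L := linear_of (tlift_linear lB).
rewrite -[tlift _ _]/(L _) tlift_comp; apply: eq_tlift => a1 a2.
rewrite tlift_comp; apply: eq_tlift => b1 b2.
by rewrite /L /= tliftE.
Qed.

End Sweedler.


Section Hat.
Variables (k : fieldType) (A : hopfAlgType k).

Lemma sweedlerD (M : lmodType k) (phi psi : seq A -> seq A -> M) s :
  sweedler s (fun xs ys => phi xs ys + psi xs ys) =
  sweedler s phi + sweedler s psi.
Proof.
rewrite -[sweedler s phi]scale1r; apply: sweedler_comb => xs ys _ _.
by rewrite scale1r.
Qed.

Lemma sweedler0 (M : lmodType k) s : sweedler s (fun _ _ : seq A => 0 : M) = 0.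
Proof. exact/esym/(sweedler_comp (\0 : {linear M -> M}) (fun _ _ => 0)). Qed.

Lemma sweedlerZ (M : lmodType k) (phi : seq A -> seq A -> M) c s :
  sweedler s (fun xs ys => c *: phi xs ys) = c *: sweedler s phi.
Proof.
rewrite -[RHS]addr0 -[X in _ = _ + X](sweedler0 M s).
by apply: sweedler_comb => xs ys _ _; rewrite addr0.
Qed.

Lemma sweedler_sum (M : lmodType k) (I : Type) (r : seq I)
    (phi : I -> seq A -> seq A -> M) s :
  sweedler s (fun xs ys => \sum_(i <- r) phi i xs ys) =
  \sum_(i <- r) sweedler s (phi i).
Proof.
elim: r => [|i r IH].
  rewrite big_nil -[RHS](sweedler0 M s).
  by apply: eq_sweedler => xs ys _ _; rewrite big_nil.
rewrite big_cons -IH -sweedlerD.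
by apply: eq_sweedler => xs ys _ _; rewrite big_cons.
Qed.

Section HatCochain.
Variables (n : nat) (f : cochain A n (trivial_bimod A)).

(* a^1_1 ... a^n_1 f(a^1_2 ⊗ ... ⊗ a^n_2) for s = [:: a^1; ...; a^n] *)
Definition hat_form (s : seq A) : A :=
  sweedler s (fun xs ys => (f (tpure n ys) : k) *: (\prod_(x <- xs) x : A)).

Lemma prod_multilin m : multilin m (fun xs : seq A => \prod_(x <- xs) x).
Proof.
move=> s1 s2 _ c x y; rewrite !big_cat /= !big_cons.
by rewrite mulrDl mulrDr -scalerAl -scalerAr.
Qed.

Lemma hat_bimultilin :
  bimultilin n (fun xs ys => (f (tpure n ys) : k) *: (\prod_(x <- xs) x : A)).
Proof.
split=> zs _; first exact/multilin_scale/prod_multilin.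
move=> s1 s2 e c x y.
by rewrite (multilin_comp f e) scalerDl scalerA.
Qed.

Lemma hat_form_multilin : multilin n hat_form.
Proof. exact/sweedler_multilin/hat_bimultilin. Qed.

Definition hat : cochain A n (regular_bimod A) :=
  linear_of (tplift_linear hat_form_multilin).

Lemma hatE s : size s = n -> hat (tpure n s) = hat_form s.
Proof. exact/tpliftE/hat_form_multilin. Qed.
End HatCochain.

Lemma hat_linear n : linear (@hat n).
Proof.
move=> c f g; apply/linmapP/tpow_ext => s sn.
rewrite [RHS]/(c *: hat f (tpure n s) + hat g (tpure n s)) !hatE //.
apply: sweedler_comb => xs ys _ _.
rewrite -[(c *: f + g) _]/(c *: f (tpure n ys) + g (tpure n ys)).
by rewrite scalerDl scalerA.
Qed.
HB.instance Definition _ n := GRing.isLinear.Build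
  k (cochain A n (trivial_bimod A)) (cochain A n (regular_bimod A)) *:%R
  (@hat n) (@hat_linear n).

Lemma hat_lact n (f : cochain A n (trivial_bimod A)) a s :
  sweedler (a :: s) (fun xs ys =>
    (counit ys`_0 * f (tpure n (behead ys)) : k) *: (\prod_(x <- xs) x : A))
  = a * hat_form f s.
Proof.
rewrite /= -[in RHS](counitr a).
pose L := linear_of ((mulr_bilin A).1 (hat_form f s)).
rewrite -[RHS]/(L _) tlift_comp; apply: eq_tlift => x y.
rewrite /L /= -scalerAl.
have E : linear (fun z : A => counit y *: (x * z)).
  by move=> c u v; rewrite mulrDr scalerDr -scalerAr !scalerA mulrC.
rewrite -[RHS]/(linear_of E _) sweedler_comp; apply: eq_sweedler => xs ys _ _.
by rewrite /= big_cons -scalerAr !scalerA.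
Qed.

Lemma hat_ract n (f : cochain A n (trivial_bimod A)) a s : size s = n ->
  sweedler (rcons s a) (fun xs ys =>
    (f (tpure n (take n ys)) * counit ys`_n : k) *: (\prod_(x <- xs) x : A))
  = hat_form f s * a.
Proof.
move=> sn; rewrite -cats1 sweedler_cat.
pose L := linear_of ((mulr_bilin A).1 a).
rewrite -[RHS]/(L _) /hat_form sweedler_comp.
apply: eq_sweedler => xs ys _; rewrite sn => ysE.
rewrite /L /= -scalerAl -[in RHS](counitr a).
pose c : k := f (tpure n ys).
have E : linear (fun z : A => c *: ((\prod_(x <- xs) x) * z)).
  by move=> e u v; rewrite mulrDr scalerDr -scalerAr !scalerA mulrC.
rewrite -[RHS]/(linear_of E _) tlift_comp; apply: eq_tlift => x y.
rewrite /= take_size_cat // nth_cat ysE ltnn subnn /=.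
by rewrite big_cat big_seq1 -scalerAr scalerA.
Qed.

Lemma hat_mul_adj n (f : cochain A n (trivial_bimod A)) s i :
  size s = n.+1 -> (i < n)%N ->
  sweedler s (fun xs ys =>
    (f (tpure n (take i ys ++ ys`_i * ys`_i.+1 :: drop i.+2 ys)) : k)
      *: (\prod_(x <- xs) x : A))
  = hat_form f (take i s ++ s`_i * s`_i.+1 :: drop i.+2 s).
Proof.
move=> sn lt_in; have i2 : (i.+1 < size s)%N by rewrite sn ltnS.
rewrite -[in LHS](cat_take_drop i s) (drop_nth 0) ?(ltn_trans _ i2) //.
rewrite (drop_nth 0 i2) /hat_form !sweedler_cat.
have sz1 : size (take i s) = i by rewrite size_takel // ltnW ?(ltn_trans _ i2).
apply: eq_sweedler => xs ys; rewrite sz1 => xsE ysE.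
set t := drop _ _.
have tE : size t = (n - i.+1)%N by rewrite size_drop sn subSS.
rewrite (@sweedlerM _ _ (n - i.+1)) //; last first.
  split=> zs zsE s1 s2 e c x y; last first.
    rewrite !catA (multilin_comp f) ?scalerDl ?scalerA //.
    by rewrite size_cat ysE -addnA -addnS e; lia.
  rewrite !catA (@prod_multilin _ (xs ++ s1) s2 erefl c x y).
  by rewrite scalerDr !scalerA mulrC.
rewrite /=; apply: eq_tlift => a1 a2; apply: eq_tlift => b1 b2.
apply: eq_sweedler => xs' ys' _ ysE'.
rewrite take_size_cat // !nth_cat ysE ltnn subnn ltnNge leqnSn /=.
rewrite subSn // subnn /=.
rewrite (_ : drop i.+2 (ys ++ [:: a2, b2 & ys']) = ys'); last first.
  by rewrite -[[:: a2, b2 & ys']]/([:: a2; b2] ++ ys') catA drop_size_cat //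
    size_cat ysE addn2.
by rewrite !big_cat /= !big_cons !mulrA.
Qed.

Lemma hat_hoch_d n (f : cochain A n (trivial_bimod A)) :
  hat (hoch_d f) = hoch_d (hat f).
Proof.
apply/linmapP/tpow_ext => s sn; rewrite hatE // hoch_dE //.
pose T1 xs ys : A :=
  (counit ys`_0 * f (tpure n (behead ys)) : k) *: (\prod_(x <- xs) x : A).
pose T2 (i : 'I_n) xs ys : A :=
  (f (tpure n (take i ys ++ ys`_i * ys`_i.+1 :: drop i.+2 ys)) : k)
    *: (\prod_(x <- xs) x : A).
pose T3 xs ys : A :=
  (f (tpure n (take n ys)) * counit ys`_n : k) *: (\prod_(x <- xs) x : A).
have -> : hat_form (hoch_d f) s = sweedler s (fun xs ys =>
    T1 xs ys + \sum_(i < n) (-1) ^+ i.+1 *: T2 i xs ys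
    + (-1) ^+ n.+1 *: T3 xs ys).
  apply: eq_sweedler => xs ys _; rewrite sn => ysE.
  rewrite hoch_dE // /hoch_form !scalerDl; congr (_ + _ + _).
    rewrite scaler_suml; apply: eq_bigr => i _.
    by rewrite /T2; apply/esym/scalerA.
  by rewrite /T3; apply/esym/scalerA.
rewrite !sweedlerD sweedler_sum sweedlerZ /hoch_form.
congr (_ + _ + _).
- case: s sn => // a s [sn]; rewrite [LHS]hat_lact -hatE //.
- apply: eq_bigr => i _; rewrite sweedlerZ hat_mul_adj // hatE //.
  rewrite size_cat /= size_takel ?size_drop sn; last by case: i => /= i; lia.
  by case: i => /= i; lia.
- congr (_ *: _); case/lastP: s sn => // s a; rewrite size_rcons => -[sn].
  by rewrite hat_ract // -cats1 take_size_cat // nth_cat sn ltnn subnn hatE.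
Qed.

Section HatCohomology.
Variable n : nat.

Lemma hat_cocycle (f : cocycle (trivial_bimod A) n) :
  hat f \in @cocycles k A (regular_bimod A) n.
Proof.
by have /eqP df := cocycleP f; apply/eqP; rewrite -hat_hoch_d df raddf0.
Qed.

Definition hatZ (f : cocycle (trivial_bimod A) n) : cocycle (regular_bimod A) n :=
  Cocycle (hat_cocycle f).

(* The class of f is sent to the class of hat f: see hatH_class. *)
Definition hatH (x : HH (trivial_bimod A) n) : HH (regular_bimod A) n :=
  hclass (hatZ (lrepr x)).

End HatCohomology.

Lemma hat_coboundary n (f : cochain A n (trivial_bimod A)) :
  is_coboundary (M := trivial_bimod A) f ->
  is_coboundary (M := regular_bimod A) (hat f).
Proof.
case: n f => [|n] f /=; first by move=> ->; rewrite raddf0.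
by case=> g ->; exists (hat g); rewrite hat_hoch_d.
Qed.

Lemma hatH_class n (f : cocycle (trivial_bimod A) n) :
  hatH (hclass f) = hclass (hatZ f).
Proof.
apply/lproj_eq/asboolP.
have /asboolP/hat_coboundary := lrepr_projB (@coboundaries _ _ (trivial_bimod A) n) f.
by rewrite raddfB.
Qed.

Section Brace.
Variables (M : lmodType k) (p q : nat) (i : 'I_p.+1).
Variables (F : cochain A p.+1 M) (G : cochain A q A).

(* The arguments of F are numbered from 0, so this is F ∘_(i+1) G in 1-based *)
(* numbering, where s = a^1, ..., a^i, b^1, ..., b^q, a^(i+2), ..., a^(p+1). *)
Definition brace_form (s : seq A) : M :=
  F (tpure p.+1 (take i s ++ G (tpure q (take q (drop i s))) :: drop (i + q) s)).

Lemma brace_form_multilin : multilin (p + q) brace_form.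
Proof.
apply: (multilin_insert (phi := fun s => F (tpure p.+1 s))
  (psi := fun s => G (tpure q s))); first exact: leq_ord.
  exact: multilin_comp.
exact: multilin_comp.
Qed.

Definition brace : cochain A (p + q) M :=
  linear_of (tplift_linear brace_form_multilin).

Lemma braceE s : size s = (p + q)%N -> brace (tpure (p + q) s) = brace_form s.
Proof. exact/tpliftE/brace_form_multilin. Qed.
End Brace.

(* The smallest family of subspaces of the C^n(A, A) containing the cochains *)
(* hat f, for f a cocycle, and stable under the brace operations. A brace of *)
(* two cocycles need not be a cocycle, so that the operations on cohomology  *)
(* are those given by cocycles obtained from such cochains, as the           *)
(* Gerstenhaber bracket is.                                                  *)
Inductive brace_span : forall n, cochain A n (regular_bimod A) -> Prop :=
| brace_span_hat n (f : cocycle (trivial_bimod A) n) : brace_span (hat f)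
| brace_span_lin n (c : k) (F G : cochain A n (regular_bimod A)) :
    brace_span F -> brace_span G -> brace_span (c *: F + G)
| brace_span_brace p q (i : 'I_p.+1) (F : cochain A p.+1 (regular_bimod A))
    (G : cochain A q (regular_bimod A)) :
    brace_span F -> brace_span G -> brace_span (brace i F G).

End Hat.

(* Main.v *)
Require Import Defs.
From mathcomp Require Import all_boot ssralg.
From mathcomp Require Import zify.

Set Implicit Arguments.
Unset Strict Implicit.
Unset Printing Implicit Defensive.

Import GRing.Theory.
Local Open Scope ring_scope.

(** In Sweedler notation applied to whole tensors t = a^1 ⊗ ... ⊗ a^q, the
    cochain hat g sends t to t_1 g(t_2), where t_1 stands for the product of
    its entries in A.  Since the coproduct is multiplicative and coassociative,
    it satisfies Δ(hat g (t)) = t_1 ⊗ t_2 g(t_3) = t_1 ⊗ hat g (t_2): the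
    cochain hat g is a map of left comodules ([comul_hat_form]).  Hence, for
    s ⊗ t ⊗ u with t in the slot of G = hat g,
      hat f (s ⊗ G(t) ⊗ u) = s_1 t_1 u_1 f(s_2 ⊗ G(t_2) ⊗ u_2),
    which is the value at s ⊗ t ⊗ u of the hat of f ∘_i G ([brace_hat]).

    Therefore every cochain built from hats by linear combinations and braces
    is again of the form hat f.  Applying the counit to hat f gives back f
    ([counit_hat]), so hat is injective; as it commutes with the Hochschild
    differentials, f is a cocycle as soon as hat f is.  So a cocycle of the
    brace span is the hat of a cocycle, and its class lies in the image. *)

Section Coalgebra.
Variables (k : fieldType) (A : hopfAlgType k).

(** The identity [comulA] in A ⊗ (A ⊗ A), transported by the linear map which
    T induces there. *)
Lemma comul_coassoc (M : lmodType k) (T : A -> A -> A -> M) a :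
  (forall y z, linear (fun x => T x y z)) ->
  (forall x z, linear (fun y => T x y z)) ->
  (forall x y, linear (T x y)) ->
  tlift (fun x y => tlift (fun x1 x2 => T x1 x2 y) (comul x)) (comul a) =
  tlift (fun x y => tlift (fun y1 y2 => T x y1 y2) (comul y)) (comul a).
Proof.
move=> T1 T2 T3.
have lT x : bilin (T x) by split=> [z|y]; [apply: T2 | apply: T3].
have lW : bilin (fun x => tlift (T x)).
  split=> [w c x x'|x]; last exact: tlift_linear.
  by apply: tlift_comb => y z; apply: T1.
pose L := linear_of (tlift_linear lW).
have := congr1 L (comulA a); rewrite !(tlift_comp _ L) => E.
transitivity (tlift (fun x y => L (tlift (fun x1 x2 => tens x1 (tens x2 y))
    (comul x))) (comul a)).
  apply: eq_tlift => x y; rewrite (tlift_comp _ L); apply: eq_tlift => x1 x2.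
  by rewrite /L /= !tliftE.
by rewrite E; apply: eq_tlift => x y; rewrite /L /= tliftE.
Qed.

Lemma sweedler_tlift (M : lmodType k) (U V : lmodType k)
    (B : seq A -> seq A -> U -> V -> M) s t :
  sweedler s (fun xs ys => tlift (B xs ys) t) =
  tlift (fun u v => sweedler s (fun xs ys => B xs ys u v)) t.
Proof.
rewrite tlift_sum; under eq_sweedler do rewrite tlift_sum.
by rewrite sweedler_sum; apply: eq_bigr => z _; rewrite sweedlerZ.
Qed.

(** Coassociativity of the coalgebra A^{⊗n}, tested on a trilinear map; it is
    inherited from A factor by factor. *)
Lemma sweedler_coassoc (M : lmodType k) (phi : seq A -> seq A -> seq A -> M) s :
  (forall ys zs, multilin (size s) (fun xs => phi xs ys zs)) ->
  (forall xs zs, multilin (size s) (fun ys => phi xs ys zs)) ->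
  (forall xs ys, multilin (size s) (phi xs ys)) ->
  sweedler s (fun xs ys => sweedler xs (fun xs1 xs2 => phi xs1 xs2 ys)) =
  sweedler s (fun xs ys => sweedler ys (fun ys1 ys2 => phi xs ys1 ys2)).
Proof.
elim: s phi => [//|a s IH] phi phi1 phi2 phi3 /=.
pose T x y z := sweedler s (fun xs ys => sweedler ys (fun ys1 ys2 =>
  phi (x :: xs) (y :: ys1) (z :: ys2))).
transitivity (tlift (fun x y => tlift (fun x1 x2 => T x1 x2 y) (comul x))
    (comul a)).
  apply: eq_tlift => x y; rewrite sweedler_tlift; apply: eq_tlift => x1 x2.
  apply: IH => [ys zs|xs zs|xs ys].
  - exact/(multilin_cons (phi := fun xs => phi xs (x2 :: ys) (y :: zs)))/phi1.
  - exact/(multilin_cons (phi := fun ys => phi (x1 :: xs) ys (y :: zs)))/phi2.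
  - exact/(multilin_cons (phi := phi (x1 :: xs) (x2 :: ys)))/phi3.
rewrite comul_coassoc => [|y z c x x'|x z c y y'|x y c z z'].
- by apply: eq_tlift => x y; rewrite sweedler_tlift.
- apply: sweedler_comb => xs ys xsE ysE; apply: sweedler_comb => ys1 ys2 _ _.
  by apply: (phi1 _ _ [::] xs); rewrite xsE.
- apply: sweedler_comb => xs ys xsE ysE; apply: sweedler_comb => ys1 ys2 yE _.
  by apply: (phi2 _ _ [::] ys1); rewrite yE ysE.
- apply: sweedler_comb => xs ys xsE ysE; apply: sweedler_comb => ys1 ys2 _ yE.
  by apply: (phi3 _ _ [::] ys2); rewrite yE ysE.
Qed.

Lemma comul_prod (s : seq A) :
  comul (\prod_(x <- s) x) =
  sweedler s (fun xs ys => tens (\prod_(x <- xs) x) (\prod_(y <- ys) y)).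
Proof.
elim: s => [|a s IH] /=; first by rewrite !big_nil comul1.
rewrite big_cons comulM IH /tmul; apply: eq_tlift => x y.
have lB : bilin (fun u v => tens (x * u) (y * v)).
  split=> [v c u u'|u c v v'].
    by rewrite mulrDr -scalerAr (tens_bilinear _ _).1.
  by rewrite mulrDr -scalerAr (tens_bilinear _ _).2.
rewrite -[LHS]/(linear_of (tlift_linear lB) _) sweedler_comp.
by apply: eq_sweedler => xs ys _ _; rewrite /= tliftE // !big_cons.
Qed.

(** The left counit law ε(s_1) s_2 = s of the coalgebra A^{⊗n}, tested on a
    linear map. *)
Lemma sweedler_counit (M : lmodType k) (psi : seq A -> M) s :
  multilin (size s) psi ->
  sweedler s (fun xs ys => (counit (\prod_(x <- xs) x) : k) *: psi ys) = psi s.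
Proof.
elim: s psi => [|a s IH] psi lpsi /=; first by rewrite big_nil counit1 scale1r.
have la : linear (fun x => psi (x :: s)) by apply: (lpsi [::]).
rewrite -[in RHS](counitl a) -[RHS]/(linear_of la _) tlift_comp.
apply: eq_tlift => x y; rewrite linearZ /= -(IH (fun s => psi (y :: s))).
  rewrite -sweedlerZ; apply: eq_sweedler => xs ys _ _.
  by rewrite big_cons counitM scalerA.
exact: multilin_cons.
Qed.

End Coalgebra.

Section HatBrace.
Variables (k : fieldType) (A : hopfAlgType k).

(** The product of the entries of s_1 has counit ε(s_1), so this is the counit
    law ε(s_1) f(s_2) = f(s). *)
Lemma counit_hat n (f : cochain A n (trivial_bimod A)) s : size s = n ->
  counit (hat f (tpure n s)) = f (tpure n s).
Proof.
move=> sn; rewrite hatE // /hat_form sweedler_comp.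
rewrite -(sweedler_counit (psi := fun s => f (tpure n s))); last first.
  by rewrite sn; apply: multilin_comp.
by apply: eq_sweedler => xs ys _ _; rewrite linearZ; apply: mulrC.
Qed.

Lemma hat_inj n : injective (@hat k A n).
Proof.
move=> f g fg; apply/linmapP/tpow_ext => s sn.
by rewrite -!counit_hat // fg.
Qed.

(** hat g is a map of left comodules: Δ(t_1 g(t_2)) = t_1 ⊗ t_2 g(t_3). *)
Lemma comul_hat_form n (g : cochain A n (trivial_bimod A)) t : size t = n ->
  comul (hat_form g t) =
  sweedler t (fun xs ys => tens (\prod_(x <- xs) x) (hat_form g ys)).
Proof.
move=> tn; pose phi xs ys zs : tensor A A :=
  (g (tpure n zs) : k) *: tens (\prod_(x <- xs) x) (\prod_(y <- ys) y).
transitivity (sweedler t (fun xs ys =>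
    sweedler xs (fun xs1 xs2 => phi xs1 xs2 ys))).
  rewrite /hat_form sweedler_comp; apply: eq_sweedler => xs ys _ _.
  by rewrite linearZ /= comul_prod -sweedlerZ.
rewrite sweedler_coassoc ?tn.
- apply: eq_sweedler => xs ys _ _; set u := \prod_(x <- xs) x.
  rewrite -[RHS]/(linear_of ((tens_bilinear _ _).2 u) _) /hat_form.
  rewrite sweedler_comp; apply: eq_sweedler => ys1 ys2 _ _.
  by rewrite linearZ.
- move=> ys zs; apply: multilin_scale => s1 s2 e c x y.
  by rewrite (prod_multilin e) (tens_bilinear _ _).1.
- move=> xs zs; apply: multilin_scale => s1 s2 e c x y.
  by rewrite (prod_multilin e) (tens_bilinear _ _).2.
- move=> xs ys s1 s2 e c x y.
  by rewrite /phi (multilin_comp g e) scalerDl scalerA.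
Qed.

(** By colinearity of hat g, splitting G(t) under the coproduct amounts to
    splitting the entries of t and evaluating g on their last factors only, so
    both sides are s_1 t_1 u_1 f(s_2 ⊗ t_2 g(t_3) ⊗ u_2). *)
Lemma brace_hat p q (i : 'I_p.+1) (f : cochain A p.+1 (trivial_bimod A))
    (g : cochain A q (trivial_bimod A)) :
  brace i (hat f) (hat g) = hat (brace i f (hat g)).
Proof.
apply/linmapP/tpow_ext => s sn; have ip := ltn_ord i.
have sz1 : size (take i s) = i by rewrite size_takel // sn; lia.
have szt : size (take q (drop i s)) = q.
  by rewrite size_takel // size_drop sn; lia.
have szu : size (drop (i + q) s) = (p - i)%N by rewrite size_drop sn; lia.
rewrite braceE // /brace_form !hatE //; last first.
  by rewrite size_cat /= sz1 szu; lia.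
have sE : s = take i s ++ take q (drop i s) ++ drop (i + q) s.
  by rewrite addnC -drop_drop !cat_take_drop.
rewrite [in RHS]sE {sE sn}.
move: (take i s) (take q (drop i s)) (drop (i + q) s) sz1 szt szu => s1 t u sz1 szt szu.
have := comul_hat_form g szt; set G := hat_form g t => comulG.
rewrite /hat_form !sweedler_cat.
apply: eq_sweedler => xs ys _; rewrite sz1 => ysE.
rewrite [LHS]/= comulG.
(* s_1 and s_2 are now fixed as xs and ys, and B x y is the sum over u which
   arises when the entry G of the list splits as x ⊗ y. *)
pose B x y := sweedler u (fun xs' ys' =>
  (f (tpure p.+1 (ys ++ y :: ys')) : k) *: (\prod_(z <- xs ++ x :: xs') z : A)).
have lB : bilin B.
  split=> [y c x x'|x c y y']; apply: sweedler_comb => xs' ys' _ ysE'.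
    by rewrite (prod_multilin erefl) scalerDr !scalerA mulrC.
  by rewrite (multilin_comp f) ?scalerDl ?scalerA // ysE ysE' szu; lia.
rewrite -[LHS]/(linear_of (tlift_linear lB) _) sweedler_comp sweedler_cat.
apply: eq_sweedler => xt yt _; rewrite szt => ytE.
rewrite [LHS]/= tliftE //; apply: eq_sweedler => xs' ys' _ ysE'.
rewrite braceE ?size_cat ?ysE ?ytE ?ysE' ?szu; last by lia.
rewrite /brace_form take_size_cat // drop_size_cat // take_size_cat // hatE //.
rewrite catA drop_size_cat ?size_cat ?ysE ?ytE //.
by rewrite !big_cat big_cons /= mulrA.
Qed.

Lemma brace_span_is_hat n (F : cochain A n (regular_bimod A)) :
  brace_span F -> exists f, F = hat f.
Proof.
elim=> {n F} [n f|n c F G _ [f ->] _ [g ->]|p q i F G _ [f ->] _ [g ->]].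
- by exists f.
- by exists (c *: f + g); rewrite linearP.
- by exists (brace i f (hat g)); rewrite brace_hat.
Qed.

(** hat reflects cocycles because it is an injective map of complexes. *)
Lemma hat_cocycle_inv n (f : cochain A n (trivial_bimod A)) :
  hat f \in @cocycles k A (regular_bimod A) n ->
  f \in @cocycles k A (trivial_bimod A) n.
Proof.
move=> /eqP df; apply/eqP/hat_inj.
by rewrite hat_hoch_d df raddf0.
Qed.

End HatBrace.

Theorem theorem2p1 (k : fieldType) (A : hopfAlgType k) :
  [/\ forall (p q : nat) (i : 'I_p.+1)
        (F : cochain A p.+1 (regular_bimod A))
        (G : cochain A q (regular_bimod A)),
        (exists f : cochain A p.+1 (trivial_bimod A), F = hat f) ->
        (exists g : cochain A q (trivial_bimod A), G = hat g) ->
        exists h : cochain A (p + q) (trivial_bimod A), brace i F G = hat h,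
      forall (n : nat) (F : cocycle (regular_bimod A) n),
        brace_span F ->
        exists x : HH (trivial_bimod A) n, hclass F = hatH x
    & forall (p q : nat) (i : 'I_p.+1)
        (f : cocycle (trivial_bimod A) p.+1)
        (g : cocycle (trivial_bimod A) q),
        brace i (hat f) (hat g) = hat (brace i f (hat g))].
Proof.
split=> [p q i F G [f ->] [g ->]|n F /brace_span_is_hat [f Ff]|p q i f g].
- by exists (brace i f (hat g)); apply: brace_hat.
- have Zf : f \in @cocycles k A (trivial_bimod A) n.
    by apply: hat_cocycle_inv; rewrite -Ff; apply: cocycleP.
  exists (hclass (Cocycle Zf)); rewrite hatH_class; congr hclass.
  exact: val_inj.
- exact: brace_hat.
Qed.
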